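(* Let $\mathsf G=(\mathsf V,\mathsf E)$ be a countable, locally finite, oriented, symmetric and connected graph. Suppose that $\mathsf G$ is quasi-transitive. Then, for any $\Lambda\ge1$, $\mathsf G$ has $\Lambda$-homogeneous currents, that is, $$\alpha(\mathsf G,L,\Lambda)\longrightarrow0\qquad\text{as }L\to+\infty .$$
   Context: Graphs: $\mathsf G=(\mathsf V,\mathsf E)$ has no loops; each edge $e=(e_-,e_+)\in\mathsf E\subset\mathsf V^2$ occurs together with $-e=(e_+,e_-)$. $\mathsf E_{1/2}\subset\mathsf E$ contains exactly one of $e,-e$ for every edge. $\mathsf G$ is quasi-transitive if $\mathsf E$ is composed of finitely many orbits under the natural action of the automorphism group of $\mathsf G$ on $\mathsf E$. For $r\in(0,\infty)^{\mathsf E_{1/2}}$, $\ell^2_-(\mathsf E,r)$ is the Hilbert space of functions $\theta:\mathsf E\to\mathbb R$ with $\theta(-e)=-\theta(e)$ and $\sum_{e\in\mathsf E_{1/2}}r(e)\theta(e)^2<\infty$. With $d^*\theta(x)=\sum_{e_-=x}\theta(e)$, a unit flow from $u$ to $v$ ($u\ne v$) is $\theta\in\ell^2_-(\mathsf E,r)$ with $d^*\theta=\mathbf 1_u-\mathbf 1_v$. There is a unique unit flow $i_r^{u,v}$ from $u$ to $v$ minimizing $\sum_{e\in\mathsf E_{1/2}}r(e)\theta(e)^2$; for an edge $e$, $i_r^e:=i_r^{e_-,e_+}$. $d$ is the graph distance on $\mathsf V$; for edges $e,e'$, $d(e,e')$ is the maximal distance between an endpoint of $e$ and an endpoint of $e'$.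 Define $$\alpha(\mathsf G,L,\Lambda)=\sup\Big\{\sum_{e'\in\mathsf E_{1/2}:\,d(e',e)\ge L}r(e')\,(i_r^e(e'))^2:\ e\in\mathsf E,\ r\in[1,\Lambda]^{\mathsf E_{1/2}}\Big\}.$$ *)

(* Defs.v *)
From HB Require Import structures.
From mathcomp Require Import all_boot all_order all_algebra.
From mathcomp Require Import all_classical all_reals all_analysis.

Set Implicit Arguments.
Unset Strict Implicit.
Unset Printing Implicit Defensive.

Import Order.TTheory GRing.Theory Num.Theory.
Import numFieldNormedType.Exports.

Local Open Scope classical_set_scope.
Local Open Scope ring_scope.

(* A graph on the countable vertex type V is given by its adjacency relation
   [adj]; since edges are pairs of vertices, the oriented edge set E is the
   graph of [adj].  E is symmetric without loops when [adj] is symmetric and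
   irreflexive. *)
Section Graph.
Variables (V : countType) (adj : rel V).

Definition edges : set (V * V) := [set e | adj e.1 e.2].

Definition opp_edge (e : V * V) : V * V := (e.2, e.1).

Definition half_edges (Eh : set (V * V)) : Prop :=
  Eh `<=` edges /\ forall e, edges e -> (Eh e <-> ~ Eh (opp_edge e)).

Definition locally_finite : Prop := forall x, finite_set [set y | adj x y].

Definition walk (x y : V) (n : nat) : Prop :=
  exists p : seq V, [/\ path adj x p, last x p = y & size p = n].

Definition connected_graph : Prop := forall x y, exists n, walk x y n.

Definition automorphism (f : V -> V) : Prop :=
  bijective f /\ forall x y, adj (f x) (f y) = adj x y.

Definition edge_orbit (e : V * V) : set (V * V) :=
  [set e' | exists2 f, automorphism f & e' = (f e.1, f e.2)].

Definition quasi_transitive : Prop :=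
  finite_set [set edge_orbit e | e in edges].

Lemma graph_dist_subproof (x y : V) :
  (exists n, walk x y n) -> exists n, `[< walk x y n >].
Proof. by case=> n xyn; exists n; apply/asboolP. Qed.

(* The value 0 when y is not reachable from x is never met in a connected
   graph. *)
Definition graph_dist (x y : V) : nat :=
  if pselect (exists n, walk x y n) is left xy then ex_minn (graph_dist_subproof xy)
  else 0%N.

Definition edge_dist (e e' : V * V) : nat :=
  maxn (maxn (graph_dist e.1 e'.1) (graph_dist e.1 e'.2))
       (maxn (graph_dist e.2 e'.1) (graph_dist e.2 e'.2)).

End Graph.

(* Functions on E are represented by functions on V * V vanishing outside E,
   and r : Eh -> R by any function on V * V, of which only the values on Eh are
   used. *)
Section Currents.
Variables (R : realType) (V : countType) (adj : rel V) (Eh : set (V * V)).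
Implicit Types (r theta : V * V -> R) (e : V * V) (u v x : V).

Definition energy r theta : \bar R :=
  \esum_(e in Eh) (r e * theta e ^+ 2)%:E.

Definition ell2_anti r theta : Prop :=
  [/\ forall e, ~ edges adj e -> theta e = 0,
      forall e, edges adj e -> theta (opp_edge e) = - theta e &
      (energy r theta < +oo)%E].

(* The index set is finite in a locally finite graph. *)
Definition dstar theta x : R :=
  \sum_(e \in edges adj `&` [set e | e.1 = x]) theta e.

Definition unit_flow r u v theta : Prop :=
  ell2_anti r theta /\ forall x, dstar theta x = (x == u)%:R - (x == v)%:R.

Definition minimal_unit_flow r u v theta : Prop :=
  unit_flow r u v theta /\
  forall eta, unit_flow r u v eta -> (energy r theta <= energy r eta)%E.

(* For r > 0 on Eh and a connected graph there is exactly one minimal unit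
   flow, so that the default value of [xget] is not used. *)
Definition current r u v : V * V -> R :=
  xget (fun=> 0) [set theta | minimal_unit_flow r u v theta].

(* The supremum is taken in [0, +oo]: adding 0 only matters for a graph without
   edges, where [ereal_sup set0] would be -oo. *)
Definition alpha (L Lambda : R) : \bar R :=
  ereal_sup (0%E |` [set s | exists e r,
    [/\ edges adj e,
        forall e', Eh e' -> 1 <= r e' <= Lambda &
        s = \esum_(e' in Eh `&` [set e' | L <= (edge_dist adj e' e)%:R])
              (r e' * current r e.1 e.2 e' ^+ 2)%:E]]).

Definition homogeneous_currents (Lambda : R) : Prop :=
  alpha L Lambda @[L --> +oo] --> 0%E.

End Currents.

(* Main.v *)
(* Fix an edge e and suppose that some minimal flows theta_n, for weights r_n in
   [1, Lambda], keep energy larger than eps outside the ball of radius n.  Since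
   theta_n has energy at most that of the flow through e alone, hence at most
   Lambda, theta_n has a pointwise limit theta along an ultrafilter, and theta
   is a unit flow of finite energy.  Minimality bounds the r_n-energy of theta_n
   by that of theta; on a large ball the two differ by little, since theta_n
   tends to theta pointwise and r_n <= Lambda, and outside it theta has little
   energy, so theta_n has little energy there too: a contradiction.  No limit of
   the r_n is needed, nor the existence or uniqueness of minimal flows (the
   default current is 0).  Automorphisms transport minimal flows, so that finitely
   many edges e suffice. *)
Require Import Defs.
From mathcomp Require Import all_boot all_order all_algebra.
From mathcomp Require Import finmap.
From mathcomp Require Import all_classical all_reals all_analysis.
From mathcomp Require Import lra.

Set Implicit Arguments.
Unset Strict Implicit.
Unset Printing Implicit Defensive.

Import Order.TTheory GRing.Theory Num.Theory.
Import numFieldNormedType.Exports.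

Local Open Scope classical_set_scope.
Local Open Scope ring_scope.

(** * Distances, automorphisms and representatives of unoriented edges *)

Section Graphs.
Context {V : countType} {adj : rel V}.
Implicit Types (x y u v : V) (e : V * V) (n N : nat).

Lemma walk_graph_dist x y n : walk adj x y n -> walk adj x y (graph_dist adj x y).
Proof.
move=> xyn; rewrite /graph_dist; case: pselect => [xy|]; last by case; exists n.
by case: ex_minnP => m /asboolP.
Qed.

Lemma walkS x y n : walk adj x y n.+1 -> exists2 z, adj x z & walk adj z y n.
Proof. by move=> [[|z p] [//= /andP[xz zp] <- [<-]]]; exists z => //; exists p. Qed.

Lemma finite_walk y n : symmetric adj -> locally_finite adj ->
  finite_set [set x | walk adj x y n].
Proof.
move=> adj_sym adj_lf; elim: n => [|n IHn].
  by apply: (@sub_finite_set _ _ [set y]) => // x [[|? ?] [_ /= xy //]].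
apply: sub_finite_set (bigcup_finite IHn (fun z _ => adj_lf z)).
by move=> x /walkS[z xz zy]; exists z => //=; rewrite adj_sym.
Qed.

(** Both endpoints of such an [e'] are at distance less than [N] from [e.1], so [e'] lies in the
    square of a finite ball. *)
Lemma finite_edge_ball e N : symmetric adj -> locally_finite adj ->
  connected_graph adj -> finite_set [set e' | (edge_dist adj e' e < N)%N].
Proof.
move=> adj_sym adj_lf adj_conn.
have fin_ball : finite_set (\bigcup_(n in `I_N) [set x | walk adj x e.1 n]).
  by apply: bigcup_finite => // n _; exact: finite_walk.
apply: sub_finite_set (finite_setX fin_ball fin_ball) => e' /=.
rewrite /edge_dist !gtn_max => /andP[/andP[lt1 _] /andP[lt2 _]].
have [[n1 w1] [n2 w2]] := (adj_conn e'.1 e.1, adj_conn e'.2 e.1).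
by split; [exists (graph_dist adj e'.1 e.1)|exists (graph_dist adj e'.2 e.1)] => //=;
  apply: walk_graph_dist; eassumption.
Qed.

Lemma edge_dist_opp e e' : edge_dist adj (opp_edge e) e' = edge_dist adj e e'.
Proof. exact: maxnC. Qed.

Lemma opp_edgeK : involutive (@opp_edge V).
Proof. by case. Qed.

Lemma automorphism_inv f g : automorphism adj f -> cancel f g -> cancel g f ->
  automorphism adj g.
Proof.
by move=> [_ fE] fK gK; split=> [|x y]; [exists f|rewrite -fE !gK].
Qed.

Lemma automorphism_walk f x y n : automorphism adj f ->
  walk adj x y n -> walk adj (f x) (f y) n.
Proof.
move=> [_ fE] [p [xp <- <-]]; exists (map f p); split; last exact: size_map.
  by rewrite (mono_path fE).
by rewrite last_map.
Qed.

(** The set of walk lengths determines the distance, including the default value when that set is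
    empty. *)
Lemma eq_graph_dist x y x' y' : (forall n, walk adj x y n <-> walk adj x' y' n) ->
  graph_dist adj x y = graph_dist adj x' y'.
Proof.
move=> xy; rewrite /graph_dist.
case: pselect => [w|w]; case: pselect => [w'|w'] //.
- case: ex_minnP => m /asboolP/xy wm minm.
  case: ex_minnP => m' /asboolP/xy wm' minm'.
  by apply/eqP; rewrite eqn_leq minm ?minm'//; apply/asboolP => //; exact/xy.
- by case: w'; case: w => n /xy; exists n.
- by case: w; case: w' => n /xy; exists n.
Qed.

Lemma automorphism_graph_dist f x y : automorphism adj f ->
  graph_dist adj (f x) (f y) = graph_dist adj x y.
Proof.
move=> f_auto; have [[g fK gK] _] := f_auto.
have g_auto := automorphism_inv f_auto fK gK.
apply: eq_graph_dist => n; split; last exact: automorphism_walk.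
by move=> /(automorphism_walk g_auto); rewrite !fK.
Qed.

Definition edge_map (f : V -> V) e : V * V := (f e.1, f e.2).

Lemma edge_mapK f g : cancel f g -> cancel (edge_map f) (edge_map g).
Proof. by move=> fK [x y]; rewrite /edge_map /= !fK. Qed.

Lemma edges_map f e : automorphism adj f ->
  edges adj (edge_map f e) <-> edges adj e.
Proof. by move=> [_ fE]; rewrite /edges /= fE. Qed.

Lemma edge_dist_map f e e' : automorphism adj f ->
  edge_dist adj (edge_map f e) (edge_map f e') = edge_dist adj e e'.
Proof. by move=> f_auto; rewrite /edge_dist !automorphism_graph_dist. Qed.

Lemma edge_orbit_refl e : edge_orbit adj e e.
Proof. by exists id; [split=> //; exists id|case: e]. Qed.

Lemma edges_opp e : symmetric adj -> edges adj e -> edges adj (opp_edge e).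
Proof. by move=> adj_sym; rewrite /edges /= adj_sym. Qed.

Definition half_rep (Eh : set (V * V)) e := if e \in Eh then e else opp_edge e.

Context {Eh : set (V * V)} (Eh_half : half_edges adj Eh).

Lemma half_rep_in e : edges adj e -> Eh (half_rep Eh e).
Proof.
rewrite /half_rep; case: ifPn => [/set_mem //|/negP eNEh adje].
apply: contrapT => oNEh; apply: eNEh; apply/mem_set.
by have [_ /(_ e adje)[_]] := Eh_half; exact.
Qed.

Lemma half_rep_opp e : edges adj e -> half_rep Eh (opp_edge e) = half_rep Eh e.
Proof.
move=> adje; have [_ /(_ e adje) EhN] := Eh_half.
rewrite /half_rep opp_edgeK; case: ifPn => [/set_mem oEh|/negP oNEh].
  by case: ifPn => // /set_mem/EhN.
by case: ifPn => [//|/negP[]]; apply/mem_set/EhN => /mem_set.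
Qed.

Lemma half_rep_id e : Eh e -> half_rep Eh e = e.
Proof. by move=> /mem_set; rewrite /half_rep => ->. Qed.

(** [f] commutes with reversal, and the outer [half_rep] forgets the orientation. *)
Lemma half_rep_map f e : automorphism adj f -> edges adj e ->
  half_rep Eh (edge_map f (half_rep Eh e)) = half_rep Eh (edge_map f e).
Proof.
move=> f_auto adje; rewrite {2}/half_rep; case: ifPn => // _.
by rewrite -[edge_map f _]/(opp_edge (edge_map f e)) half_rep_opp//; apply/edges_map.
Qed.

Lemma half_rep_mapK f g e : automorphism adj f -> automorphism adj g ->
  cancel f g -> Eh e -> half_rep Eh (edge_map g (half_rep Eh (edge_map f e))) = e.
Proof.
move=> f_auto g_auto fK Ehe; have [/(_ e Ehe) adje _] := Eh_half.
by rewrite half_rep_map ?(edge_mapK fK) ?half_rep_id//; apply/edges_map.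
Qed.

(** An automorphism permutes the unoriented edges; this is that permutation read on [Eh], its
    inverse being built in the same way from [g]. Stability of [A] under reversal makes membership
    independent of the representative. *)
Lemma half_rep_map_bij f (A : set (V * V)) : automorphism adj f ->
  (forall e, A (opp_edge e) <-> A e) ->
  set_bij (Eh `&` edge_map f @^-1` A) (Eh `&` A) (half_rep Eh \o edge_map f).
Proof.
move=> f_auto A_opp; have [[g fK gK] _] := f_auto.
have g_auto := automorphism_inv f_auto fK gK.
have [EhE _] := Eh_half.
have A_rep e : A (half_rep Eh e) <-> A e.
  by rewrite /half_rep; case: ifP => // _; apply: A_opp.
split.
- move=> e /= [Ehe Afe]; split; last exact/A_rep.
  by apply/half_rep_in/edges_map => //; exact: EhE.
- move=> e e' /set_mem[Ehe _] /set_mem[Ehe' _] /= /(congr1 (half_rep Eh \o edge_map g)).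
  by rewrite /= !half_rep_mapK.
- move=> e [Ehe Ae]; exists (half_rep Eh (edge_map g e)); last first.
    by rewrite /= half_rep_mapK.
  split; first by apply/half_rep_in/edges_map => //; exact: EhE.
  by apply/A_rep; rewrite half_rep_mapK.
Qed.

End Graphs.

(** * Energies and flows under automorphisms *)

Section Flows.
Context {R : realType} {V : countType} {adj : rel V} {Eh : set (V * V)}.
Hypothesis (Eh_half : half_edges adj Eh).
Implicit Types (r theta eta : V * V -> R) (A F : set (V * V)) (u v x : V).

Lemma energy_ge0 A r theta : (forall e, A e -> 0 <= r e) ->
  (0 <= energy A r theta)%E.
Proof.
by move=> r0; apply: esum_ge0 => e Ae; rewrite lee_fin mulr_ge0 ?sqr_ge0 ?r0.
Qed.

Lemma energy_split F A r theta : (forall e, A e -> 0 <= r e) ->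
  energy A r theta = (energy (A `&` F) r theta + energy (A `&` ~` F) r theta)%E.
Proof.
by move=> r0; apply: esumID => e Ae; rewrite lee_fin mulr_ge0 ?sqr_ge0 ?r0.
Qed.

Lemma energy_subset F A r theta : (forall e, A e -> 0 <= r e) -> F `<=` A ->
  (energy F r theta <= energy A r theta)%E.
Proof.
move=> r0 FA; rewrite (energy_split (A := A) F)// (setIidr FA) leeDl//.
by apply: energy_ge0 => e [/r0].
Qed.

Lemma energy_finite F r theta : finite_set F -> (forall e, F e -> 0 <= r e) ->
  energy F r theta = (\sum_(e <- fset_set F) r e * theta e ^+ 2)%:E.
Proof.
move=> finF r0; rewrite /energy esum_fset// => [|e /set_mem Fe].
  by rewrite fsbig_finite// sumEFin.
by rewrite lee_fin mulr_ge0 ?sqr_ge0 ?r0.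
Qed.

Lemma eq_energy A r r' theta eta : {in A, r =1 r'} -> {in A, theta =1 eta} ->
  energy A r theta = energy A r' eta.
Proof.
by move=> rr te; apply: eq_esum => e /mem_set Ae; rewrite rr// te.
Qed.

Lemma energy_le_finite A r theta (c : R) :
  (forall F, finite_set F -> F `<=` A ->
    \sum_(e <- fset_set F) r e * theta e ^+ 2 <= c) ->
  (energy A r theta <= c%:E)%E.
Proof.
move=> Fc; apply: ge_ereal_sup => _ [F [finF FA] <-].
by rewrite fsbig_finite// sumEFin lee_fin Fc.
Qed.

(* Eh need not be invariant under f, so a weight is transported through the
   representative in Eh of the image edge. *)
Definition transport f r e := r (half_rep Eh (edge_map f e)).

(** Reindexing along [half_rep_map_bij]; the sign that appears when the representative reverses the
    image edge disappears in the square. *)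
Lemma energy_transport f A r theta : automorphism adj f ->
  (forall e, A (opp_edge e) <-> A e) ->
  (forall e, edges adj e -> theta (opp_edge e) = - theta e) ->
  energy (Eh `&` A) r theta =
  energy (Eh `&` edge_map f @^-1` A) (transport f r) (theta \o edge_map f).
Proof.
move=> f_auto A_opp thetaN; have [EhE _] := Eh_half.
rewrite {1}/energy (reindex_esum _ _ _ _ (half_rep_map_bij Eh_half f_auto A_opp)).
apply: eq_esum => e [/EhE Ee _] /=; congr (_ * _)%:E.
rewrite /half_rep; case: ifP => // _.
by rewrite thetaN ?sqrrN//; apply/edges_map.
Qed.

Lemma energy_transportT f r theta : automorphism adj f ->
  (forall e, edges adj e -> theta (opp_edge e) = - theta e) ->
  energy Eh r theta = energy Eh (transport f r) (theta \o edge_map f).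
Proof.
move=> f_auto thetaN; have := energy_transport r f_auto _ thetaN.
by move=> /(_ setT); rewrite preimage_setT !setIT; exact.
Qed.

Lemma dstar_map f theta x : automorphism adj f ->
  dstar adj (theta \o edge_map f) x = dstar adj theta (f x).
Proof.
move=> f_auto; have [[g fK gK] _] := f_auto.
rewrite /dstar [RHS](reindex_fsbig (edge_map f)
  (edges adj `&` [set e | e.1 = x]))//; split.
- by move=> e [Ee <-]; split => //; apply/edges_map.
- by move=> e e' _ _ /(can_inj (edge_mapK fK)).
- move=> e [Ee ex]; exists (edge_map g e); last exact: edge_mapK.
  split; last by rewrite /= ex fK.
  by apply/edges_map => //; exact: automorphism_inv fK gK.
Qed.

Lemma unit_flow_transport f r u v theta : automorphism adj f ->
  unit_flow adj Eh r (f u) (f v) theta ->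
  unit_flow adj Eh (transport f r) u v (theta \o edge_map f).
Proof.
move=> f_auto [[theta0 thetaN theta_fin] theta_flow].
have [[g fK _] _] := f_auto.
split; first split.
- by move=> e Ne; apply: theta0 => /(edges_map _ f_auto).
- by move=> e Ee; apply: (thetaN (edge_map f e)); apply/edges_map.
- by rewrite -energy_transportT.
- by move=> x; rewrite dstar_map// theta_flow !(can_eq fK).
Qed.

(** Transporting a weight by [f] and then back by its inverse is only known to restore it on [Eh],
    hence this congruence. *)
Lemma eq_unit_flow r r' u v theta : {in Eh, r =1 r'} ->
  unit_flow adj Eh r u v theta -> unit_flow adj Eh r' u v theta.
Proof.
move=> rr' [[theta0 thetaN theta_fin] theta_flow]; split=> //; split=> //.
by rewrite (eq_energy (r' := r) (eta := theta))// => e Ehe; rewrite rr'.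
Qed.

(** A competitor [eta] is carried back by the inverse [g] to a competitor of [theta] with the same
    energy. *)
Lemma minimal_unit_flow_transport f r u v theta : automorphism adj f ->
  minimal_unit_flow adj Eh r (f u) (f v) theta ->
  minimal_unit_flow adj Eh (transport f r) u v (theta \o edge_map f).
Proof.
move=> f_auto [theta_flow theta_min]; split; first exact: unit_flow_transport.
move=> eta eta_flow; have [[_ thetaN _] _] := theta_flow.
have [[_ etaN _] _] := eta_flow.
have [[g fK gK] _] := f_auto.
have g_auto := automorphism_inv f_auto fK gK.
have rE : {in Eh, transport g (transport f r) =1 r}.
  by move=> e /set_mem Ehe; rewrite /transport (half_rep_mapK Eh_half).
rewrite -energy_transportT// (energy_transportT _ g_auto etaN).
rewrite (eq_energy rE (fun=> fun=> erefl)); apply: theta_min.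
by apply: eq_unit_flow rE _; apply: unit_flow_transport => //; rewrite !fK.
Qed.

End Flows.

(** * Ultrafilter limits and finite families *)

Lemma ultra_fmap (T U : Type) (f : T -> U) (F : set_system T) :
  UltraFilter F -> UltraFilter (f @ F).
Proof.
move=> FU; split; first exact: fmap_proper_filter.
move=> G GP FG; apply/seteqP; split=> [A GA|]; last exact: FG.
(* If the preimage of [A] were not in [F], its complement would be, and [G] would contain both [A]
   and its complement. *)
have [//|FnAf] := in_ultra_setVsetC (f @^-1` A) FU.
have /filter_ex[x []//] : G (A `&` ~` A) by apply: filterI => //; exact: FG.
Qed.

(** Compactness of the segment from [- c] to [c], in its ultrafilter form. *)
Lemma bounded_ultra_cvg (R : realType) (T : Type) (F : set_system T)
    (f : T -> R) (c : R) : UltraFilter F -> (forall t, `|f t| <= c) ->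
  cvg (f t @[t --> F]).
Proof.
move=> FU fc; have := @segment_compact R (- c) c; rewrite compact_ultra.
move=> /(_ _ (ultra_fmap f FU)) [].
  apply: (@filterE _ F) => t /=; rewrite in_itv /=.
  by have := fc t; rewrite ler_norml.
by move=> l [_ fl]; apply/cvg_ex; exists l.
Qed.

(** Serves both for a finite set of edges and for the finite set of edge orbits. *)
Lemma near_finite (T : choiceType) (I : Type) (F : set_system I) (A : set T)
    (P : T -> I -> Prop) : Filter F -> finite_set A ->
  (forall a, A a -> \forall i \near F, P a i) ->
  \forall i \near F, forall a, A a -> P a i.
Proof.
move=> FF /finite_seqP[s ->]; elim: s => [_|a s IHs Ps]; first exact: filterE.
have Pa : \forall i \near F, P a i by apply: Ps; rewrite /= mem_head.
have {}IHs : \forall i \near F, forall b, [set` s] b -> P b i.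
  by apply: IHs => b bs; apply: Ps; rewrite /= inE bs orbT.
apply: filterS2 Pa IHs => i Pai Psi b; rewrite /= inE => /predU1P[->//|].
exact: Psi.
Qed.

Lemma cvg_sum_seq (R : realType) (T : Type) (I : eqType) (F : set_system T)
    (s : seq I) (f : T -> I -> R) (l : I -> R) : Filter F ->
  (forall i, f t i @[t --> F] --> l i) ->
  \sum_(i <- s) f t i @[t --> F] --> \sum_(i <- s) l i.
Proof.
move=> FF fl; apply: (@cvg_big _ _ _ 0 xpredT _ _ F s (fun i t => f t i)) => // x.
exact: add_continuous.
Qed.

Lemma sum_seq_eq (R : pzRingType) (I : eqType) (s : seq I) (a : I) : uniq s ->
  \sum_(i <- s) (i == a)%:R = (a \in s)%:R :> R.
Proof.
move=> s_uniq; have [a_s|aNs] := boolP (a \in s).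
  by rewrite (bigD1_seq a)//= eqxx big1 ?addr0// => i /negPf ->.
rewrite big1_seq// => i /= i_s; case: eqVneq => // ia.
by rewrite -ia i_s in aNs.
Qed.

(** * Uniform tail bound at one fixed edge *)

Section Limits.
Context {R : realType} {V : countType} {adj : rel V} {Eh : set (V * V)}.
Hypotheses (adj_sym : symmetric adj) (Eh_half : half_edges adj Eh).
Hypotheses (adj_lf : locally_finite adj) (adj_conn : connected_graph adj).
Context {Lambda : R} (Lambda_ge1 : 1 <= Lambda).
Implicit Types (r theta : V * V -> R) (A F : set (V * V)) (u v x : V).
Implicit Types (e : V * V).

(** One unit sent through [e] itself: the competitor that bounds the energy of every minimal flow
    from [e.1] to [e.2]. *)
Definition edge_flow e e' : R := (e' == e)%:R - (e' == opp_edge e)%:R.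

Lemma finite_edges_from x : finite_set (edges adj `&` [set e | e.1 = x]).
Proof.
apply: sub_finite_set (finite_setX (finite_set1 x) (adj_lf x)).
by move=> [y z] [/= yz <-].
Qed.

(** Exactly one of [e] and its opposite is in [Eh], so only one of the two indicators survives
    there. *)
Lemma edge_flow_sqr e e' : edges adj e -> Eh e' ->
  edge_flow e e' ^+ 2 = (e' == half_rep Eh e)%:R.
Proof.
move=> Ee Ehe'; have [_ /(_ e Ee) EhN] := Eh_half.
rewrite /edge_flow /half_rep; case: ifPn => [/set_mem Ehe|/negP eNEh].
  have /negPf -> : e' != opp_edge e.
    by apply/eqP => e'E; rewrite e'E in Ehe'; exact: (EhN.1 Ehe).
  by rewrite subr0; case: eqP; rewrite ?expr1n ?expr0n.
have /negPf -> : e' != e by apply/eqP => e'E; apply/eNEh/mem_set; rewrite -e'E.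
by rewrite sub0r sqrrN; case: eqP; rewrite ?expr1n ?expr0n.
Qed.

Lemma energy_edge_flow r e : edges adj e ->
  (forall e', Eh e' -> 1 <= r e' <= Lambda) ->
  (energy Eh r (edge_flow e) <= Lambda%:E)%E.
Proof.
move=> Ee rL; apply: energy_le_finite => F finF FEh.
apply: (@le_trans _ _ (\sum_(e' <- fset_set F) Lambda * (e' == half_rep Eh e)%:R)).
  rewrite big_seq [leRHS]big_seq; apply: ler_sum => e'; rewrite in_fset_set//.
  move=> /set_mem/FEh Ehe'; rewrite edge_flow_sqr// ler_wpM2r//.
  by have /andP[] := rL _ Ehe'.
rewrite -mulr_sumr sum_seq_eq ?fset_uniq//; case: (_ \in _); rewrite ?mulr1 ?mulr0//.
exact: le_trans ler01 Lambda_ge1.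
Qed.

Lemma edge_flow_unit r e : edges adj e ->
  (forall e', Eh e' -> 1 <= r e' <= Lambda) ->
  unit_flow adj Eh r e.1 e.2 (edge_flow e).
Proof.
move=> Ee rL; split; first split.
- move=> e' Ne'; rewrite /edge_flow; case: eqP => [e'E|_]; first by rewrite e'E in Ne'.
  case: eqP => [e'E|_]; last by rewrite subrr.
  by case: Ne'; rewrite e'E; exact: edges_opp.
- move=> e' _; rewrite /edge_flow opprB (inv_eq (@opp_edgeK V)).
  by rewrite (inj_eq (inv_inj (@opp_edgeK V))).
- exact: le_lt_trans (energy_edge_flow Ee rL) (ltry _).
- move=> x; have finx := finite_edges_from x.
  rewrite /dstar fsbig_finite// sumrB !sum_seq_eq ?fset_uniq//.
  rewrite !in_fset_set//; congr (_%:R - _%:R); congr nat_of_bool.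
    by apply/idP/eqP => [/set_mem[] //|->]; apply/mem_set.
  apply/idP/eqP => [/set_mem[] //|->]; apply/mem_set; split=> //.
  exact: edges_opp.
Qed.

Lemma energy_minimal_le r e theta : edges adj e ->
  (forall e', Eh e' -> 1 <= r e' <= Lambda) ->
  minimal_unit_flow adj Eh r e.1 e.2 theta -> (energy Eh r theta <= Lambda%:E)%E.
Proof.
move=> Ee rL [_ theta_min]; apply: le_trans (energy_edge_flow Ee rL).
by apply: theta_min; exact: edge_flow_unit.
Qed.

(** Weights at least 1 turn the energy bound into one free of [r], which can pass to a limit while
    the weights vary. *)
Lemma energy_bound_finite r theta (c : R) F :
  (forall e', Eh e' -> 1 <= r e' <= Lambda) -> (energy Eh r theta <= c%:E)%E ->
  finite_set F -> F `<=` Eh -> \sum_(e <- fset_set F) theta e ^+ 2 <= c.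
Proof.
move=> rL thetac finF FEh.
have r0 e' : Eh e' -> 0 <= r e' by move=> /rL/andP[/(le_trans ler01)].
have := le_trans (energy_subset theta r0 FEh) thetac.
rewrite energy_finite// => [|e' /FEh/r0//]; rewrite lee_fin; apply: le_trans.
rewrite big_seq [leRHS]big_seq; apply: ler_sum => e'; rewrite in_fset_set//.
by move=> /set_mem/FEh/rL/andP[r1 _]; rewrite ler_peMl ?sqr_ge0.
Qed.

Lemma unit_flow_bound r u v theta (c : R) e : 1 <= c ->
  (forall e', Eh e' -> 1 <= r e' <= Lambda) ->
  unit_flow adj Eh r u v theta -> (energy Eh r theta <= c%:E)%E -> `|theta e| <= c.
Proof.
move=> c1 rL [[theta0 thetaN _] _] thetac.
have [Ee|Ne] := pselect (edges adj e); last first.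
  by rewrite theta0// normr0 (le_trans ler01).
have -> : `|theta e| = `|theta (half_rep Eh e)|.
  by rewrite /half_rep; case: ifP => // _; rewrite thetaN// normrN.
have h_sub : [set half_rep Eh e] `<=` Eh.
  by move=> _ ->; exact: (half_rep_in Eh_half Ee).
have := energy_bound_finite rL thetac (finite_set1 _) h_sub.
rewrite fset_set1 big_seq_fset1 => sq_le.
(* A single term of the energy gives [theta e ^+ 2 <= c], and [c <= c ^+ 2] because [1 <= c]; this
   avoids a square root. *)
rewrite -(ler_pXn2r (n := 2)) ?nnegrE ?normr_ge0 ?(le_trans ler01)//.
rewrite -normrX ger0_norm ?sqr_ge0// (le_trans sq_le)// expr2 ler_peMl//.
exact: le_trans ler01 c1.
Qed.

(** [F] comes within [eps] of the supremum that defines the energy. *)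
Lemma energy_tail A r theta (eps : R) : (forall e, A e -> 0 <= r e) ->
  (energy A r theta < +oo)%E -> 0 < eps ->
  exists F, [/\ finite_set F, F `<=` A & (energy (A `&` ~` F) r theta <= eps%:E)%E].
Proof.
move=> r0 theta_fin eps0.
have Efin : energy A r theta \is a fin_num by rewrite ge0_fin_numE// energy_ge0.
have [_ [F [finF FA] <-]] := ub_ereal_sup_adherent eps0 Efin.
rewrite fsbig_finite// sumEFin => ltF; exists F; split => //.
have EF : energy F r theta = (\sum_(e <- fset_set F) r e * theta e ^+ 2)%:E.
  by apply: energy_finite => // e /FA/r0.
have {}ltF : (energy A r theta - eps%:E <
    (\sum_(e <- fset_set F) r e * theta e ^+ 2)%:E)%E by exact: ltF.
move: ltF; rewrite (energy_split F _ r0) (setIidr FA) EF.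
have : energy (A `&` ~` F) r theta \is a fin_num.
  rewrite ge0_fin_numE ?(le_lt_trans _ theta_fin)//.
    by apply: energy_subset => //; exact: subIsetl.
  by apply: energy_ge0 => e [/r0].
case: (energy (A `&` ~` F) r theta) => // t _.
rewrite -EFinD lte_fin lee_fin; lra.
Qed.

(** Support, antisymmetry and divergence are identities between finitely many values, so they pass
    to pointwise limits; finiteness of the energy is a Fatou argument on finite sets of edges. All
    weights in [1, Lambda] being comparable, any such [r] is admissible for the limit. *)
Lemma unit_flow_limit (T : Type) (U : set_system T) (rn thetan : T -> V * V -> R)
    r theta u v (c : R) : ProperFilter U ->
  (forall t e, Eh e -> 1 <= rn t e <= Lambda) ->
  (forall e, Eh e -> 1 <= r e <= Lambda) ->
  (forall t, unit_flow adj Eh (rn t) u v (thetan t)) ->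
  (forall t, (energy Eh (rn t) (thetan t) <= c%:E)%E) ->
  (forall e, thetan t e @[t --> U] --> theta e) ->
  unit_flow adj Eh r u v theta.
Proof.
move=> UP rnL rL flow_n thetac thetal.
have eq_lim (f : T -> R) (a b : R) : f t @[t --> U] --> a -> f = (fun=> b) -> a = b.
  by move=> + fb; rewrite {}fb => fa; apply: (cvg_unique (@Rhausdorff R) fa (cvg_cst b)).
split; first split.
- move=> e Ne; apply: (eq_lim _ _ _ (thetal e)); apply/funext => t.
  by have [[theta0 _ _] _] := flow_n t; exact: theta0.
- move=> e Ee; apply/eqP; rewrite -addr_eq0; apply/eqP.
  apply: (eq_lim _ _ _ (cvgD (thetal (opp_edge e)) (thetal e))).
  apply/funext => t; have [[_ thetaN _] _] := flow_n t.
  by rewrite /= thetaN// addNr.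
(* [c] bounds the unweighted sums and [Lambda] bounds the weight [r]. *)
- apply: (@le_lt_trans _ _ (Lambda * c)%:E); last exact: ltry.
  apply: energy_le_finite => F finF FEh.
  apply: (@le_trans _ _ (\sum_(e <- fset_set F) Lambda * theta e ^+ 2)).
    rewrite big_seq [leRHS]big_seq; apply: ler_sum => e; rewrite in_fset_set//.
    by move=> /set_mem/FEh/rL/andP[_ rl]; rewrite ler_wpM2r ?sqr_ge0.
  rewrite -mulr_sumr ler_pM2l ?(lt_le_trans ltr01)//.
  apply: (@cvgr_to_le _ U _ _ (fun t => \sum_(e <- fset_set F) thetan t e ^+ 2)).
    by apply: cvg_sum_seq => e; under eq_fun do rewrite expr2; exact: cvgM.
  apply: filterE => t; exact: energy_bound_finite (rnL t) (thetac t) finF FEh.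
- move=> x; have finx := finite_edges_from x.
  rewrite /dstar fsbig_finite//.
  apply: (eq_lim _ _ _ (cvg_sum_seq _ thetal)); apply/funext => t.
  by have [_ /(_ x)] := flow_n t; rewrite /dstar fsbig_finite.
Qed.

Lemma minimal_flow_tail e (eps : R) : edges adj e -> 0 < eps ->
  exists N : nat, forall r theta, (forall e', Eh e' -> 1 <= r e' <= Lambda) ->
    minimal_unit_flow adj Eh r e.1 e.2 theta ->
    (energy (Eh `&` [set e' | (N <= edge_dist adj e' e)%N]) r theta <= eps%:E)%E.
Proof.
move=> Ee eps0; apply: contrapT => /forallNP no_bound.
(* The failure of each [N] yields, by choice, a sequence of weights paired with minimal flows. *)
have {no_bound} /choice[rt rtP] N : exists rt : (V * V -> R) * (V * V -> R),
    [/\ forall e', Eh e' -> 1 <= rt.1 e' <= Lambda,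
      minimal_unit_flow adj Eh rt.1 e.1 e.2 rt.2 &
      (eps%:E < energy (Eh `&` [set e' | (N <= edge_dist adj e' e)%N]) rt.1 rt.2)%E].
  have /existsNP[r /existsNP[theta /not_implyP[rL /not_implyP[tmin /negP]]]] :=
    no_bound N.
  by rewrite -ltNge => tail; exists (r, theta).
pose rn n := (rt n).1; pose thetan n := (rt n).2.
have rnL n : forall e', Eh e' -> 1 <= rn n e' <= Lambda by have [] := rtP n.
have rn0 n e' : Eh e' -> 0 <= rn n e' by move=> /(rnL n)/andP[/(le_trans ler01)].
have min_n n : minimal_unit_flow adj Eh (rn n) e.1 e.2 (thetan n) by have [] := rtP n.
have energy_n n := energy_minimal_le Ee (rnL n) (min_n n).
(* An ultrafilter finer than [\oo] gives limits at all edges at once, in place of a diagonal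
   subsequence. *)
have [U [UU ooU]] := ultraFilterLemma (F := \oo) _.
pose theta e' := lim (thetan n e' @[n --> U]).
have thetal e' : thetan n e' @[n --> U] --> theta e'.
  apply: (bounded_ultra_cvg (c := Lambda)) => n.
  exact: (unit_flow_bound _ Lambda_ge1 (rnL n) (min_n n).1 (energy_n n)).
(* Two weights matter below: the constant [Lambda], for the tail of [theta], and [rn n], for the
   comparison with [thetan n]. *)
have theta_flow r : (forall e', Eh e' -> 1 <= r e' <= Lambda) ->
    unit_flow adj Eh r e.1 e.2 theta.
  move=> rL; exact: unit_flow_limit rnL rL (fun n => (min_n n).1) energy_n thetal.
have Lambda0 : 0 <= Lambda := le_trans ler01 Lambda_ge1.
have [[_ _ theta_fin] _] : unit_flow adj Eh (fun=> Lambda) e.1 e.2 theta.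
  by apply: theta_flow => e' _; rewrite Lambda_ge1 lexx.
have eps20 : 0 < eps / 2 by rewrite divr_gt0.
(* The weight [Lambda] dominates every [rn n], so one finite set [F] controls the tail of [theta]
   for all [n]; the other half of [eps] is kept for the ball. *)
have [F [finF FEh F_tail]] := energy_tail (fun=> fun=> Lambda0) theta_fin eps20.
(* The radius [N] is such that the ball around [e] contains [F]. *)
have [N _ FN] : \forall N \near \oo, forall e', F e' -> (edge_dist adj e' e < N)%N.
  by apply: near_finite => // e' _; exact: nbhs_infty_gt.
pose B := Eh `&` [set e' | (edge_dist adj e' e < N)%N].
have finB : finite_set B.
  apply: sub_finite_set (finite_edge_ball e N adj_sym adj_lf adj_conn).
  by move=> e' [].
have farE : ~` [set e' | (edge_dist adj e' e < N)%N] =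
    [set e' | (N <= edge_dist adj e' e)%N].
  by apply/seteqP; split=> e' /=; rewrite (leqNgt N) => /negP; exact.
have theta_tail n :
    (energy (Eh `&` [set e' | (N <= edge_dist adj e' e)%N]) (rn n) theta <=
     (eps / 2)%:E)%E.
  apply: le_trans F_tail; apply: (@le_trans _ _ (energy
      (Eh `&` [set e' | (N <= edge_dist adj e' e)%N]) (fun=> Lambda) theta)).
    apply: le_esum => e' [/(rnL n)/andP[_ rl] _]; rewrite lee_fin.
    by apply: ler_wpM2r rl; exact: sqr_ge0.
  apply: energy_subset => // e' [Ehe' /= far]; split=> // /FN.
  by move=> /(_ N (leqnn N)); rewrite ltnNge far.
(* [B] is finite, so pointwise convergence suffices; the factor [Lambda] and the absolute values
   make the estimate valid whatever [rn n] is. *)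
have near_B : \forall n \near U, \sum_(e' <- fset_set B)
    Lambda * `|theta e' ^+ 2 - thetan n e' ^+ 2| <= eps / 2.
  have lim0 : \sum_(e' <- fset_set B) Lambda * `|theta e' ^+ 2 - thetan n e' ^+ 2|
      @[n --> U] --> \sum_(e' <- fset_set B) Lambda * `|theta e' ^+ 2 - theta e' ^+ 2|.
    apply: cvg_sum_seq => e'; apply: cvgM; first exact: cvg_cst.
    apply: cvg_norm; apply: cvgB; first exact: cvg_cst.
    by under eq_fun do rewrite expr2; rewrite expr2; exact: cvgM.
  rewrite big1 in lim0; last by move=> e' _; rewrite subrr normr0 mulr0.
  exact: (cvgr_le _ lim0).
have /filter_ex[n [/= Nn Bn]] : \forall n \near U, (N <= n)%N /\ \sum_(e' <- fset_set B)
    Lambda * `|theta e' ^+ 2 - thetan n e' ^+ 2| <= eps / 2.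
  by apply: filterI near_B; apply: ooU; exact: nbhs_infty_ge.
have [_ _] := rtP n; apply/negP; rewrite -leNgt -/(rn n) -/(thetan n).
(* Since [N <= n], the edges at distance at least [n], on which [rtP n] asserts a large energy, are
   among those at distance at least [N]. *)
apply: (@le_trans _ _ (energy (Eh `&` [set e' | (N <= edge_dist adj e' e)%N])
    (rn n) (thetan n))).
  apply: energy_subset => [e' [/(rn0 n)//]|e' [Ehe' /= far]]; split=> //=.
  exact: leq_trans far.
(* Minimality of [thetan n] against [theta], with both energies split at the ball of radius [N]. *)
have := (min_n n).2 _ (theta_flow _ (rnL n)).
rewrite (energy_split [set e' | (edge_dist adj e' e < N)%N] _ (rn0 n)).
rewrite [leRHS](energy_split [set e' | (edge_dist adj e' e < N)%N] _ (rn0 n)).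
rewrite farE -/B.
have energyB eta : energy B (rn n) eta =
    (\sum_(e' <- fset_set B) rn n e' * eta e' ^+ 2)%:E.
  by apply: energy_finite => // e' [/(rn0 n)].
rewrite !energyB.
move: (theta_tail n).
have : \sum_(e' <- fset_set B) rn n e' * theta e' ^+ 2 -
    \sum_(e' <- fset_set B) rn n e' * thetan n e' ^+ 2 <= eps / 2.
  apply: le_trans Bn; rewrite -sumrB big_seq [leRHS]big_seq; apply: ler_sum => e'.
  rewrite in_fset_set// => /set_mem[Ehe' _]; rewrite -mulrBr.
  apply: le_trans (ler_wpM2l (rn0 n _ Ehe') (ler_norm _)) _.
  by apply: ler_wpM2r; rewrite ?normr_ge0//; have /andP[] := rnL n _ Ehe'.
(* Inside the ball, [a] is the energy of [thetan n] and [b] that of [theta]; outside, [s] is that of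
   [theta] and [t] that of [thetan n]. From [a + t <= b + s], [b - a <= eps / 2] and [s <= eps / 2]
   follows [t <= eps]. *)
move: (\sum_(e' <- _) _) (\sum_(e' <- _) _) => a b ab.
move: (energy _ _ theta) (energy _ _ (thetan n)) => s t s_le t_le.
have : (a%:E + t <= b%:E + (eps / 2)%:E)%E by apply: le_trans t_le _; rewrite leeD2l.
case: t {t_le} => [t| |] //=.
  by rewrite -!EFinD !lee_fin; lra.
by move=> _; exact: leNye.
Qed.

End Limits.

(** * From one edge to all edges, through finitely many orbits *)

Theorem corollary3p11 (R : realType) (V : countType) (adj : rel V)
    (Eh : set (V * V))
    (adj_irr : irreflexive adj) (adj_sym : symmetric adj)
    (Eh_half : half_edges adj Eh)
    (adj_lf : locally_finite adj) (adj_conn : connected_graph adj)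
    (adj_qt : quasi_transitive adj)
    (Lambda : R) (Lambda_ge1 : 1 <= Lambda) :
  homogeneous_currents adj Eh Lambda.
Proof.
have alpha_ge0 L : (0 <= alpha adj Eh L Lambda)%E.
  by apply: ereal_sup_ubound; left.
(* As [alpha] is nonnegative, an eventual bound by each [eps] gives both finiteness for large [L]
   and convergence to 0. *)
suff alpha_le (eps : R) : 0 < eps ->
    \forall L \near +oo, (alpha adj Eh L Lambda <= eps%:E)%E.
  apply/fine_cvgP; split.
    apply: filterS (alpha_le 1 ltr01) => L aL.
    by rewrite ge0_fin_numE// (le_lt_trans aL)// ltry.
  apply/cvgrPdist_le => eps eps0; apply: filterS (alpha_le eps eps0) => L aL.
  rewrite sub0r normrN ger0_norm ?fine_ge0//= -lee_fin fineK//.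
  by rewrite ge0_fin_numE// (le_lt_trans aL)// ltry.
move=> eps0.
(* The property is phrased on orbits, which are finite in number; each orbit brings its own base
   edge [e0], and the radii are enlarged to a common [N]. *)
have [N _ tailN] : \forall N \near \oo, forall O : set (V * V),
    [set edge_orbit adj e | e in edges adj] O ->
    exists e0, [/\ edges adj e0, O = edge_orbit adj e0 & forall r theta,
      (forall e', Eh e' -> 1 <= r e' <= Lambda) ->
      minimal_unit_flow adj Eh r e0.1 e0.2 theta ->
      (energy (Eh `&` [set e' | (N <= edge_dist adj e' e0)%N]) r theta <=
       eps%:E)%E].
  apply: near_finite => // _ [e0 Ee0 <-].
  have [N0 tailN0] :=
    minimal_flow_tail adj_sym Eh_half adj_lf adj_conn Lambda_ge1 Ee0 eps0.
  exists N0 => // N /= N0N; exists e0; split=> // r theta rL theta_min.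
  apply: le_trans (tailN0 r theta rL theta_min); apply: energy_subset.
    by move=> e' [/rL/andP[/(le_trans ler01)]].
  by move=> e' [Ehe' /= far]; split=> //=; exact: leq_trans far.
(* [L] is taken at least [N]; the first case is the 0 adjoined to the supremum. *)
near=> L; apply: ge_ereal_sup => s [->|]; first by rewrite lee_fin ltW.
move=> [e [r [Ee rL ->]]].
have [e0 [Ee0 orb tail0]] := tailN N (leqnn N) _ (imageP _ Ee).
have [f f_auto eE] : edge_orbit adj e0 e by rewrite -orb; exact: edge_orbit_refl.
rewrite -/(energy _ r (current adj Eh r e.1 e.2)) /current.
case: xgetP => [theta _ theta_min|_]; last first.
  by rewrite /energy esum1 ?lee_fin ?ltW// => e' _; rewrite expr0n mulr0.
rewrite eE in theta_min.
have [[_ thetaN _] _] := theta_min.1.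
(* Reversing an edge keeps its distance to [e], so the far region is stable under reversal. *)
rewrite (energy_transport Eh_half r f_auto)//; last first.
  by move=> e'; rewrite /= edge_dist_opp.
have [EhE _] := Eh_half.
have trL e' : Eh e' -> 1 <= transport (Eh := Eh) f r e' <= Lambda.
  by move=> /EhE Ee'; apply/rL/(half_rep_in Eh_half)/edges_map.
(* The pulled-back flow is minimal between the endpoints of [e0] for a weight still in [1, Lambda],
   so the bound at [e0] applies. *)
apply: le_trans (tail0 _ _ trL (minimal_unit_flow_transport Eh_half f_auto theta_min)).
apply: energy_subset => e' [Ehe']; first by have /andP[/(le_trans ler01)] := trL e' Ehe'.
(* An edge sent by [f] to distance at least [L] from [e] is itself at distance at least [L] from
   [e0]. *)
move=> /= far; split=> //=; rewrite -(edge_dist_map _ _ f_auto) -[edge_map f e0]eE.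
rewrite -(ler_nat R); apply: le_trans far.
by near: L; exact: nbhs_pinfty_ge.
Unshelve. all: by end_near.
Qed.
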